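(* Let $k$ and $n$ be positive integers, let $m=4k+1$, and let $G=P_m\mathbin{\square} P_n$. Then $\mathrm{b}_2'(G)=2$.
   Context: $P_n$ denotes the path on $n$ vertices. The Cartesian product $G\mathbin{\square} F$ has vertex set $V(G)\times V(F)$, with $(x,y)$ and $(x',y')$ adjacent iff either $x=x'$ and $yy'\in E(F)$, or $y=y'$ and $xx'\in E(G)$. For positive integers $a,b$, the $(a,b)$-biased Maker-Breaker domination game on a graph $G$ is played by Dominator and Staller, who move alternately; on each move Dominator selects $a$ unplayed vertices and Staller selects $b$ unplayed vertices (if fewer unplayed vertices remain than the player's bias, the player selects all remaining ones). Dominator wins if the vertices he selected during the game form a dominating set of $G$; otherwise Staller wins, equivalently, Staller wins iff she claims all vertices of the closed neighborhood of some vertex. In the S-game Staller moves first, and $\mathrm{b}'_\ell(G)$ is the minimum positive integer $b$ such that Staller wins the $(\ell,b)$-biased S-game on $G$ under optimal play ($\infty$ if no such $b$ exists). *)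

(* Defs.v *)
From mathcomp Require Import all_boot.
From mathcomp Require Import boolp.

Set Implicit Arguments.
Unset Strict Implicit.
Unset Printing Implicit Defensive.

Record sgraph := SGraph {
  vertex :> finType;
  adj : rel vertex;
  adj_sym : symmetric adj;
  adj_irr : irreflexive adj }.

Definition path_adj (n : nat) : rel 'I_n :=
  fun i j => (i.+1 == j :> nat) || (j.+1 == i :> nat).

Lemma path_adj_sym n : symmetric (@path_adj n).
Proof. by move=> i j; rewrite /path_adj orbC. Qed.

Lemma path_adj_irr n : irreflexive (@path_adj n).
Proof. by move=> i; rewrite /path_adj orbb gtn_eqF. Qed.

Definition path_graph (n : nat) : sgraph :=
  SGraph (@path_adj_sym n) (@path_adj_irr n).

Definition cart_adj (G F : sgraph) : rel (G * F)%type :=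
  fun p q => (p.1 == q.1) && adj p.2 q.2 || (p.2 == q.2) && adj p.1 q.1.

Lemma cart_adj_sym G F : symmetric (@cart_adj G F).
Proof.
move=> p q; rewrite /cart_adj (eq_sym p.1) (eq_sym p.2).
by rewrite (adj_sym p.2) (adj_sym p.1).
Qed.

Lemma cart_adj_irr G F : irreflexive (@cart_adj G F).
Proof. by move=> p; rewrite /cart_adj !adj_irr !andbF. Qed.

Definition cart_prod (G F : sgraph) : sgraph :=
  SGraph (@cart_adj_sym G F) (@cart_adj_irr G F).

Definition dominating (G : sgraph) (D : {set G}) : bool :=
  [forall v, (v \in D) || [exists u in D, adj u v]].

Inductive player := Dominator | Staller.

(* In a position, D and S are the sets of vertices selected so far by
   Dominator and Staller; with bias c, the minimum below is the rule that a
   player facing fewer than c unplayed vertices takes all of them. *)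
Definition legal_move (G : sgraph) (c : nat) (D S M : {set G}) : bool :=
  (M \subset ~: (D :|: S)) && (#|M| == minn c #|~: (D :|: S)|).

(* Staller_wins a b p D S: in the (a,b)-biased game with player p to move,
   Staller has a strategy that wins against every play of Dominator. The
   derivation is the strategy: a move for each of her turns, a branch for each
   possible move of Dominator. As the relation is inductive, it is the intended
   one for a, b > 0, when every play is finite. *)
Inductive Staller_wins (G : sgraph) (a b : nat) :
  player -> {set G} -> {set G} -> Prop :=
| Staller_wins_end p D S :
    D :|: S = setT -> ~~ dominating D -> Staller_wins a b p D S
| Staller_wins_own D S M :
    D :|: S != setT -> legal_move b D S M ->
    Staller_wins a b Dominator D (S :|: M) -> Staller_wins a b Staller D S
| Staller_wins_opp D S :
    D :|: S != setT ->
    (forall M, legal_move a D S M -> Staller_wins a b Staller (D :|: M) S) ->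
    Staller_wins a b Dominator D S.

Definition Staller_wins_Sgame (G : sgraph) (a b : nat) : Prop :=
  Staller_wins a b Staller (set0 : {set G}) set0.

Definition Staller_winning_bias (l : nat) (G : sgraph) : pred nat :=
  fun b => (0 < b) && `[< Staller_wins_Sgame G l b >].

(* The threshold b'_l(G), with None standing for infinity. *)
Definition S_threshold (l : nat) (G : sgraph) : option nat :=
  match pselect (exists b, Staller_winning_bias l G b) with
  | left ex_b => Some (ex_minn ex_b)
  | right _ => None
  end.

(* Main.v *)
(** With biases (2,1), Dominator cuts every copy of the first path into
    subpaths of two or three vertices and answers a move of Staller by taking
    the rest of the subpath she played in; each vertex that Staller owns then
    has a neighbour owned by Dominator.

    With biases (2,2), Staller works on one boundary copy of the first path,
    with columns 0, ..., 4k, and takes there the columns 4t+1 and 4t+3 in her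
    turn t. For even i at most two vertices of the closed neighbourhood of the
    boundary vertex of column i are left to Dominator, all in column i; so all
    his vertices are spent on hitting, one each, the even columns below 4t.
    After k turns the 2k+1 even columns are all threatened, and he has only 2k
    vertices. *)
Require Import Defs.
From mathcomp Require Import all_boot.
From mathcomp Require Import boolp zify.

Set Implicit Arguments.
Unset Strict Implicit.
Unset Printing Implicit Defensive.

Lemma disjoint_setUl (T : finType) (A B C : {set T}) :
  [disjoint A :|: B & C] = [disjoint A & C] && [disjoint B & C].
Proof. by rewrite !disjoints_subset subUset. Qed.

Lemma disjoint_setUr (T : finType) (A B C : {set T}) :
  [disjoint A & B :|: C] = [disjoint A & B] && [disjoint A & C].
Proof. by rewrite !(disjoint_sym A) disjoint_setUl. Qed.

(** * Legal moves and claimed neighbourhoods *)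

Section Game.
Variable G : sgraph.
Implicit Types (D S M R : {set G}) (v x y z : G).

Definition closed_nbhd v : {set G} := [set u | (u == v) || adj u v].

Lemma dominatingPn D :
  reflect (exists v, [disjoint closed_nbhd v & D]) (~~ dominating D).
Proof.
rewrite negb_forall; apply: (iffP existsP) => -[v Dv]; exists v; last first.
  rewrite negb_or (disjointFr Dv) ?inE ?eqxx //=.
  apply/existsPn => u; rewrite negb_and orbC -implybE; apply/implyP => uv.
  by rewrite (disjointFr Dv) // inE uv orbT.
move: Dv; rewrite negb_or => /andP[vD /existsPn Dv].
rewrite disjoints_subset; apply/subsetP => u.
rewrite !inE => /orP[/eqP-> //|uv].
by have := Dv u; rewrite uv andbT.
Qed.

(** A maximal set of at most [c] unplayed vertices containing [R] has the legal size, since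
    otherwise a further unplayed vertex could be added. *)
Lemma legal_move_superset c D S R :
  R \subset ~: (D :|: S) -> #|R| <= c ->
  exists2 M : {set G}, legal_move c D S M & R \subset M.
Proof.
set U := ~: _ => RU Rc.
pose P M := (M \subset U) && (#|M| <= c).
have PR : P R by rewrite /P RU Rc.
have [M /maxsetP[/andP[MU Mc] Mmax] RM] := maxset_exists PR.
exists M => //; rewrite /legal_move -/U MU eqn_leq leq_min Mc subset_leq_card //=.
rewrite leqNgt leq_min; apply/negP => /andP[Mltc MltU].
have /properP[_ [x xU xM]] : M \proper U by rewrite properEcard MU.
have MxM : M \subset x |: M by rewrite subsetUr.
have := Mmax (x |: M); rewrite /P subUset sub1set xU MU cardsU1 xM Mltc.
by move=> /(_ isT MxM) E; rewrite -E setU11 in xM.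
Qed.

Lemma legal_moveP c D S M : legal_move c D S M ->
  [/\ [disjoint M & D], [disjoint M & S] & #|M| <= c].
Proof.
case/andP; rewrite setCU subsetI -!disjoints_subset => /andP[-> ->] /eqP->.
by rewrite geq_minl.
Qed.

Lemma unplayed_gt0 D S : D :|: S != setT -> 0 < #|~: (D :|: S)|.
Proof.
rewrite card_gt0; apply: contraNneq => U0.
by rewrite -[D :|: S]setCK U0 setC0.
Qed.

Lemma legal_move_unplayed c D S M : 0 < c -> D :|: S != setT ->
  legal_move c D S M ->
  #|~: (D :|: S :|: M)| < #|~: (D :|: S)|.
Proof.
move=> c0 DS /andP[MU /eqP Mc]; rewrite setCU -setDE.
by rewrite cardsD (setIidPr MU) Mc ltn_subrL leq_min c0 unplayed_gt0.
Qed.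

(** Play has to go on until the board is full; [closed_nbhd v] stays inside [S], hence away from
    [D]. The induction is on the number of unplayed vertices. *)
Lemma claimed_Staller_wins a b p D S v : 0 < a -> 0 < b ->
  [disjoint D & S] -> closed_nbhd v \subset S -> Staller_wins a b p D S.
Proof.
move=> a0 b0; have [r] := ubnP #|~: (D :|: S)|.
elim: r => // r IHr in p D S *; rewrite ltnS => Ur DS vS.
have [full|DSn] := eqVneq (D :|: S) setT.
  apply: Staller_wins_end => //; apply/dominatingPn; exists v.
  by rewrite disjoint_sym (disjointWr vS).
case: p.
  apply: Staller_wins_opp => // M legM; have [_ MS _] := legal_moveP legM.
  apply: IHr => //; last by rewrite disjoint_setUl DS.
  by rewrite setUAC (leq_trans (legal_move_unplayed _ _ legM)).
have [|M legM _] := @legal_move_superset b D S set0 (sub0set _).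
  by rewrite cards0.
have [MD _ _] := legal_moveP legM.
apply: (Staller_wins_own _ legM) => //; apply: IHr.
- by rewrite setUA (leq_trans (legal_move_unplayed _ _ legM)).
- by rewrite disjoint_setUr DS disjoint_sym.
- exact: subset_trans vS (subsetUl _ _).
Qed.

Lemma threat_Staller_wins a b D S v : 0 < a -> 0 < b -> [disjoint D & S] ->
  [disjoint closed_nbhd v & D] -> #|closed_nbhd v :\: S| <= b ->
  Staller_wins a b Staller D S.
Proof.
move=> a0 b0 DS vD vb.
have RU : closed_nbhd v :\: S \subset ~: (D :|: S).
  by rewrite setCU subsetI -!disjoints_subset (disjointWl (subsetDl _ _)) //
     disjoints_subset setDE subsetIr.
have [full|DSn] := eqVneq (D :|: S) setT.
  apply: (@claimed_Staller_wins _ _ _ _ _ v) => //.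
  by move: RU; rewrite full setCT subset0 setD_eq0.
have [M legM RM] := legal_move_superset RU vb.
have [MD _ _] := legal_moveP legM.
apply: (Staller_wins_own _ legM) => //.
apply: (@claimed_Staller_wins _ _ _ _ _ v) => //.
  by rewrite disjoint_setUr DS disjoint_sym.
by rewrite -subDset.
Qed.

(** * Dominator's strategy from a partition into cells *)

Section Cells.
Variables (T : eqType) (cell : G -> T) (a : nat).
Hypothesis cell_card : forall x, #|[set y | cell y == cell x]| <= a.+1.
Hypothesis cell_adj : forall x, exists2 y, adj y x & cell y = cell x.

(* Dominator answers a Staller move [z] by taking the rest of the cell of [z]. *)
Let answered D S x := forall y, cell y = cell x -> y != x -> y \in D.
(** When Dominator is to move, [z] is the vertex Staller has just taken, the only one possibly
    unanswered. *)
Let invariant p D S := [disjoint D & S] /\ match p with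
  | Staller => forall x, x \in S -> answered D S x
  | Dominator => exists z, [/\ z \in S,
      forall x, x \in S -> x != z -> answered D S x &
      forall y, y \in S -> cell y = cell z -> y = z]
  end.

Let invariant_dominating p D S :
  D :|: S = setT -> invariant p D S -> dominating D.
Proof.
move=> full [DS inv].
have inS x : (x \in S) = (x \notin D).
  have := in_setT x; rewrite -full inE.
  by have [xD _|//] := boolP (x \in D); rewrite (disjointFr DS).
(* An undominated [v] and its neighbour [u] in the same cell would both be Staller's, against
   [answered] or, if [v = z], against [z] being her only vertex in its cell. *)
apply: contraT => /dominatingPn[v vD].
have vnD : v \notin D by rewrite (disjointFr vD) ?inE ?eqxx.
have [u uv cuv] := cell_adj v.
have unD : u \notin D by rewrite (disjointFr vD) ?inE ?uv ?orbT.
have uv' : u != v by apply: contraTneq uv => ->; rewrite adj_irr.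
rewrite -inS in vnD.
case: p inv => [[z [_ ans one]]|ans]; last by rewrite (ans v) in unD.
have [vz|vz] := eqVneq v z; last by rewrite (ans v) in unD.
move: unD; rewrite -inS => /one; rewrite cuv -vz => /(_ erefl) /eqP.
by rewrite (negPf uv').
Qed.

Lemma cells_Dominator_wins : ~ Staller_wins_Sgame G a 1.
Proof.
suff noinv p D S : Staller_wins a 1 p D S -> ~ invariant p D S.
  by move/noinv; apply; split=> [|x]; rewrite ?inE // disjoints_subset sub0set.
elim=> {p D S} [p D S full Dn|D S M DSn legM _ IH [DS ans]|
                D S DSn _ IH [DS [z [zS ans one]]]].
- by move=> inv; rewrite (invariant_dominating full inv) in Dn.
- have [MD MS M1] := legal_moveP legM.
  have /cards1P[z Mz] : #|M| == 1.
    rewrite eqn_leq M1; case/andP: legM => _ /eqP->; rewrite leq_min /=.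
    exact: unplayed_gt0.
  rewrite {}Mz in MD MS IH *.
  apply: IH; split; first by rewrite disjoint_setUr DS disjoint_sym.
  move: MD MS; rewrite !disjoints1 => zD zS.
  exists z; split=> [|x|y]; first by rewrite !inE eqxx orbT.
    by rewrite !inE => /orP[/ans //|/eqP->]; rewrite eqxx.
  (* Had Staller owned another [y] in the cell of [z], the answer to [y] would have given [z] to
     Dominator. *)
  rewrite !inE => /orP[yS cyz|/eqP//]; apply/eqP; apply: contraNT zD => yz.
  by rewrite (ans y) // eq_sym.
set R := [set y | cell y == cell z] :\ z :\: D.
have RU : R \subset ~: (D :|: S).
  apply/subsetP => y; rewrite !inE => /and3P[yD yz /eqP cyz].
  by rewrite (negPf yD) /=; apply: contraNN yz => /one->.
have Ra : #|R| <= a.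
  apply: leq_trans (subset_leq_card (subsetDl _ _)) _.
  by have := cell_card z; rewrite (cardsD1 z) inE eqxx.
have [M legM /subsetP RM] := legal_move_superset RU Ra.
have [_ MS _] := legal_moveP legM.
apply: (IH M legM); split; first by rewrite disjoint_setUl DS.
move=> x xS y cyx yx; rewrite inE; have [xz|xz] := eqVneq x z.
  rewrite orbC -implyNb; apply/implyP => yM; apply: contraR yM => yD.
  by apply: RM; rewrite !inE yD -xz yx cyx eqxx.
by rewrite (ans x).
Qed.

End Cells.
End Game.


Lemma grid_Dominator_wins m n : 1 < m ->
  ~ Staller_wins_Sgame (cart_prod (path_graph m) (path_graph n)) 2 1.
Proof.
move=> m1; set G := cart_prod _ _.
(* Consecutive columns are paired; the cap [m./2.-1] adds the last column to the last pair when [m]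
   is odd. *)
pose cell (x : G) := (minn x.1./2 m./2.-1, x.2 : 'I_n).
apply: (@cells_Dominator_wins _ _ cell) => [x|[i j]].
  (* The offset from the left end of the cell, at most 2, determines the vertex. *)
  pose f (y : G) : 'I_3 := inord (y.1 - (cell x).1.*2).
  rewrite -[X in _ <= X]card_ord; apply: (@leq_card_in _ _ f) => -[i j] [i' j'].
  rewrite !inE /cell !xpair_eqE /= => /andP[/eqP ci /eqP->] /andP[/eqP ci' /eqP->].
  have im := ltn_ord i; have im' := ltn_ord i'.
  move/(congr1 val); rewrite /= !inordK /=; try lia.
  by move=> ii'; congr (_, _); apply: val_inj => /=; lia.
have im := ltn_ord i.
pose i' := if odd i || (i.+1 == m) then i.-1 else i.+1.
have [i'm adj_i' cell_i'] : [/\ i' < m, (i'.+1 == i) || (i.+1 == i') &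
    minn i'./2 m./2.-1 = minn i./2 m./2.-1] by rewrite /i'; case: ifP => ?; split; lia.
exists ((Ordinal i'm : 'I_m), (j : 'I_n)); last by rewrite /cell /= cell_i'.
by rewrite /= /cart_adj /= eqxx /path_adj /= adj_i' orbT.
Qed.

(** * Staller's strategy on a boundary path *)

Section Staller.
Variables k n : nat.
Let G := cart_prod (path_graph (4 * k).+1) (path_graph n.+1).
Implicit Types (D : {set G}) (p : G) (i t : nat).

(* [bd i] is the boundary vertex in column [i] (junk for [i > 4 * k]);
   [claimed t] is what Staller owns before her turn [t]. *)
Let column p : nat := (p.1 : 'I_(4 * k).+1).
Let bd i : G := (inord i : 'I_(4 * k).+1, ord0 : 'I_n.+1).
Let claimed t : {set G} :=
  [set p : G | [&& p.2 == ord0 :> 'I_n.+1, odd (column p) & column p < 4 * t]].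

(* For [t = k] the last column [4 * k] is included: it has no right neighbour
   for Staller to take. *)
Let unclaimed_nbhd t i p : ~~ odd i -> i < 4 * k + 1 -> i < 4 * t + (t == k) ->
  p \in closed_nbhd (bd i) :\: claimed t ->
  p = bd i \/ p = (inord i, inord 1).
Proof.
case: p => a b oi ik it; have ak := ltn_ord a; have bn := ltn_ord b.
rewrite !inE /= /cart_adj /= /path_adj /column /bd !xpair_eqE -!val_eqE /= inordK; last by lia.
move=> H.
have [b0|b0] := eqVneq (b : nat) 0.
  left; congr (_, _); apply: val_inj => //=; rewrite inordK; lia.
right; congr (_, _); apply: val_inj => /=; rewrite inordK; lia.
Qed.

Let claimed_wins t D : t <= k -> [disjoint D & claimed t] -> #|D| <= 2 * t ->
  Staller_wins 2 2 Staller D (claimed t).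
Proof.
have [r] := ubnP (k - t); elim: r => // r IHr in t D *; rewrite ltnS.
move=> kt tk DS Dt.
have [/existsP[i /and3P[oi it iD]]|] := boolP [exists i : 'I_(4 * k).+1,
  [&& ~~ odd i, i < 4 * t + (t == k) & [disjoint closed_nbhd (bd i) & D]]].
  apply: (threat_Staller_wins (v := bd i)) => //.
  (* If [n = 0], [inord 1] falls back to [ord0], and the bound by two still holds. *)
  apply: (@leq_trans #|[set bd i; (inord i, inord 1) : G]|).
    apply/subset_leq_card/subsetP => p /unclaimed_nbhd[]//; rewrite ?addn1 //.
      by move->; rewrite !inE eqxx.
    by move->; rewrite !inE eqxx orbT.
  by rewrite cards2; case: (_ != _).
move/existsPn => hit.
(* [s1] lists the threatened even columns, [s2] the columns of Dominator's vertices. As [s1] is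
   contained in [s2], [2 * t + (t == k) <= #|D| <= 2 * t], which excludes [t = k]. *)
pose s1 := [seq i.*2 | i <- iota 0 (2 * t + (t == k))].
pose s2 := [seq column p | p <- enum D].
have s1u : uniq s1 by rewrite map_inj_uniq ?iota_uniq //; exact: double_inj.
have s12 : {subset s1 <= s2}.
  move=> _ /mapP[i + ->]; rewrite mem_iota => /= it.
  have ik : i.*2 < (4 * k).+1 by lia.
  have := hit (Ordinal ik); rewrite /= odd_double /=.
  have -> /= : i.*2 < 4 * t + (t == k) by lia.
  case/pred0Pn => p /= /andP[pN pD]; apply/mapP; exists p; first by rewrite mem_enum.
  have := @unclaimed_nbhd t i.*2 p; rewrite odd_double addn1 inE pN (disjointFr DS pD).
  by case=> // [|->|->]; rewrite /column /= ?inordK //; lia.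
have szs2 : size s2 = #|D| by rewrite size_map cardE.
have := uniq_leq_size s1u s12; rewrite szs2 size_map size_iota => ht.
have {}tk : t < k by lia.
(* Equality in this count forces the columns met by [D] to be exactly those in [s1], so Dominator
   has nothing from column [4 * t] on. *)
have Ds p : p \in D -> ~~ odd (column p) && (column p < 4 * t).
  move=> pD; have [|_ s12E] := uniq_min_size s1u s12.
    by rewrite szs2 size_map size_iota; lia.
  have : column p \in s1 by rewrite s12E; apply/mapP; exists p; rewrite ?mem_enum.
  by case/mapP => i; rewrite mem_iota => /= it ->; rewrite odd_double; lia.
pose M := [set bd (4 * t + 1); bd (4 * t + 3)].
have SM : claimed t :|: M = claimed t.+1.
  apply/setP => -[a b]; have ak := ltn_ord a.
  by rewrite !inE /column /bd !xpair_eqE -!val_eqE /= !inordK; lia.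
have unplayed i : 4 * t <= i <= 4 * k -> bd i \notin D :|: claimed t.
  move=> it; rewrite !inE; apply/negP => /orP[/Ds|]; rewrite /column /= inordK; lia.
have not_full D' t' i :
  bd i \notin D' :|: claimed t' -> D' :|: claimed t' != setT.
  by apply: contraNneq => ->; rewrite inE.
have MU : M \subset ~: (D :|: claimed t).
  by rewrite subUset !sub1set !in_setC !unplayed //; lia.
have M2 : #|M| = 2.
  by rewrite cards2 /bd xpair_eqE -val_eqE /= !inordK; lia.
have legM : legal_move 2 D (claimed t) M.
  rewrite /legal_move MU M2 eq_sym; apply/eqP/minn_idPl.
  by rewrite -M2 subset_leq_card.
have [MD _ _] := legal_moveP legM.
have DS' : [disjoint D & claimed t.+1].
  by rewrite -SM disjoint_setUr DS disjoint_sym.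
(* The boundary vertex of the even column [4 * k] is unplayed before and after this move, so the
   game is not over. *)
apply: (Staller_wins_own _ legM).
  by apply: (not_full _ _ (4 * k)); apply: unplayed; lia.
rewrite SM; apply: Staller_wins_opp => [|M' /legal_moveP[_ MS' Mc]].
  apply: (not_full _ _ (4 * k)).
  by rewrite !inE; apply/negP => /orP[/Ds|]; rewrite /column /= inordK; lia.
apply: IHr; rewrite ?disjoint_setUl ?DS' //; first lia.
by have [+ _] := leq_card_setU D M'; lia.
Qed.

Lemma grid_Staller_wins : Staller_wins_Sgame G 2 2.
Proof.
have claimed0 : claimed 0 = set0 by apply/setP => p; rewrite !inE muln0 !andbF.
rewrite /Staller_wins_Sgame -{2}claimed0.
by apply: claimed_wins; rewrite ?disjoints_subset ?sub0set ?cards0.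
Qed.

End Staller.

Theorem corollary19 (k n m : nat) (hk : 0 < k) (hn : 0 < n)
    (hm : m = 4 * k + 1) :
  S_threshold 2 (cart_prod (path_graph m) (path_graph n)) = Some 2.
Proof.
case: n hn => // n' _; rewrite addn1 in hm; subst m.
set G := cart_prod _ _.
have win2 : Staller_winning_bias 2 G 2.
  by apply/andP; split=> //; apply/asboolP/grid_Staller_wins.
rewrite /S_threshold; case: pselect => [ex_b|]; last by case; exists 2.
case: ex_minnP => b /andP[b0 /asboolP winb] minb; congr Some.
apply/eqP; rewrite eqn_leq minb //= ltn_neqAle b0 andbT.
apply/eqP => b1; rewrite -b1 in winb.
by apply: grid_Dominator_wins winb; lia.
Qed.
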